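(* Let $u$ be a $C^2$-smooth function on $\mathbb{C}^2$ of the form $$u(z,w)=a(w)|z|^2+b(w)z^2+\overline{b(w)z^2}+c(w)z+\overline{c(w)z}+d(w),$$ where $a,b,c,d$ are $C^2$ functions on $\mathbb{C}$, with $a,d$ real-valued, $a>0$, and $b,c$ complex-valued, and suppose that $\det(\partial\bar\partial u)=1$ on $\mathbb{C}^2$. Then the zero set $Z_b:=\{w\in\mathbb{C}: b_{\bar w}(w)=0\}$ of $b_{\bar w}=\partial b/\partial\bar w$ is nonempty.
   Context: Coordinates on $\mathbb{C}^2$ are $(z,w)$. For a real-valued function $u$ on $\mathbb{C}^2$, $\partial\bar\partial u$ denotes its complex Hessian, the $2\times 2$ matrix $\begin{bmatrix} u_{\bar z z} & u_{z\bar w}\\ u_{\bar z w} & u_{\bar w w}\end{bmatrix}$. *)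

(* Defs.v *)
From Stdlib Require Import Reals.
From Coquelicot Require Import Coquelicot.
Open Scope R_scope.

(* C and C^2 as real normed spaces; C_R_NormedModule is not the canonical
   module structure on C (which is complex), hence the explicit names. *)
Definition CR : NormedModule R_AbsRing := C_R_NormedModule.
Definition CR2 : NormedModule R_AbsRing := prod_NormedModule R_AbsRing CR CR.

(* Derive is total and real-valued: dirD is meaningful where the directional
   derivative exists, as class_C below guarantees. *)
Definition dirD {V : NormedModule R_AbsRing} (v : V) (f : V -> R) (p : V) : R :=
  Derive (fun t : R => f (plus p (scal t v))) 0.

Definition dirDC {V : NormedModule R_AbsRing} (v : V) (f : V -> C) (p : V) : C :=
  (dirD v (fun q => Re (f q)) p, dirD v (fun q => Im (f q)) p).

(* For V finite-dimensional (here R^2 or R^4) this is the usual class C^k: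
   if the partial derivatives exist and are continuous up to order k, so do the
   iterated directional derivatives along all vectors.  Coquelicot's ex_diff_n
   covers functions of two real variables only. *)
Fixpoint class_C {V : NormedModule R_AbsRing} (k : nat) (f : V -> R) : Prop :=
  (forall p : V, continuous f p) /\
  match k with
  | O => True
  | S k' => forall v : V,
      (forall p : V, ex_derive (fun t : R => f (plus p (scal t v))) 0) /\
      class_C k' (dirD v f)
  end.

Definition class_CC {V : NormedModule R_AbsRing} (k : nat) (f : V -> C) : Prop :=
  class_C k (fun p => Re (f p)) /\ class_C k (fun p => Im (f p)).

(* Wirtinger derivatives (d/dx -+ i d/dy)/2 in a complex coordinate x + iy,
   where vx and vy are the direction vectors of x and y. *)
Definition wirt {V : NormedModule R_AbsRing} (vx vy : V) (f : V -> C) (p : V) : C :=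
  ((dirDC vx f p - Ci * dirDC vy f p) / 2)%C.
Definition wirtbar {V : NormedModule R_AbsRing} (vx vy : V) (f : V -> C) (p : V) : C :=
  ((dirDC vx f p + Ci * dirDC vy f p) / 2)%C.

Definition dbar1 (f : CR -> C) : CR -> C :=
  wirtbar (V := CR) (RtoC 1) Ci f.

Definition d_z (f : CR2 -> C) : CR2 -> C :=
  wirt (V := CR2) (RtoC 1, RtoC 0) (Ci, RtoC 0) f.
Definition d_zbar (f : CR2 -> C) : CR2 -> C :=
  wirtbar (V := CR2) (RtoC 1, RtoC 0) (Ci, RtoC 0) f.
Definition d_w (f : CR2 -> C) : CR2 -> C :=
  wirt (V := CR2) (RtoC 0, RtoC 1) (RtoC 0, Ci) f.
Definition d_wbar (f : CR2 -> C) : CR2 -> C :=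
  wirtbar (V := CR2) (RtoC 0, RtoC 1) (RtoC 0, Ci) f.

(* In u_{z wbar} the subscripts are read left to right: first d/dz. *)
Definition complex_hessian (u : CR2 -> R) (p : CR2) : @matrix C 2 2 :=
  let U : CR2 -> C := fun q => RtoC (u q) in
  [[d_z (d_zbar U) p, d_wbar (d_z U) p],
   [d_w (d_zbar U) p, d_w (d_wbar U) p]].

Definition det2 (M : @matrix C 2 2) : C :=
  let m := coeff_mat (RtoC 0) M in
  (m 0%nat 0%nat * m 1%nat 1%nat - m 0%nat 1%nat * m 1%nat 0%nat)%C.

Definition Zset (b : CR -> C) (w : CR) : Prop := dbar1 b w = RtoC 0.

(* Main.v *)
Require Import Defs.
From Stdlib Require Import Reals Psatz FunctionalExtensionality Classical ClassicalEpsilon.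
From Coquelicot Require Import Coquelicot.
Open Scope R_scope.

(** The equation [det = 1] is a polynomial identity in [z, zbar] with
    coefficients depending on [w].  Writing [B = b_wbar], its quadratic terms
    say that
      [a * a_(w wbar) - |a_w|^2 = 4 * |B|^2]   and   [a * B_w = 2 * a_w * B].
    The second equation says that [h = conj B / a^2] is entire, and the first
    one then reads [Laplacian (log a) = 16 * a^2 * |h|^2]: the conformal metric
    [a |h| |dw|] on the whole plane has constant negative curvature away from
    the zeros of [h].  By the Ahlfors-Schwarz argument no such metric exists
    unless [h = 0].  So [B] even vanishes identically.

    The Ahlfors-Schwarz argument: on the disc of radius [R] about a point [w0],
    let [rho = R^2 - |w - w0|^2] and maximise [|h|^2 * W] with
    [W = (a * rho)^2].  If [h w0 <> 0] and [R] is large, then the maximum is so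
    large that [Laplacian (log W) > 0] where it is attained, so that
    [log (|h|^2 * W)] would be strictly subharmonic at its own maximum.
    This contradiction is [no_local_max], used in [pseudometric_trivial].

    Since [b] is only of class [C^2], [h] is only known to be of class [C^1],
    and [log |h|] cannot be differentiated twice.  Instead, [no_local_max]
    moves all second derivatives to [W]: from the second-order jet of [W] at
    the maximum [p] one finds a complex polynomial [G] with [G p = 0] and
    [W > W p * |1 + G|^2] near [p] ([taylor_minorant]).  Then
    [|h * (1 + G)| < |h p|] on small circles about [p], which the mean value
    property of the holomorphic function [h * (1 + G)] forbids.  That property
    ([holo_mean]) requires first derivatives only. *)

(** * Functions of class C^1 and C^2 on the real plane *)

Definition dx (f : R -> R -> R) (x y : R) : R := Derive (fun s => f s y) x.
Definition dy (f : R -> R -> R) (x y : R) : R := Derive (fun t => f x t) y.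

Definition C0 (f : R -> R -> R) : Prop := forall x y : R, continuity_2d_pt f x y.

Definition C1 (f : R -> R -> R) : Prop :=
  (forall x y : R, ex_derive (fun s => f s y) x /\ ex_derive (fun t => f x t) y)
  /\ C0 (dx f) /\ C0 (dy f).

Definition C2 (f : R -> R -> R) : Prop := C1 f /\ C1 (dx f) /\ C1 (dy f).

Definition lap (f : R -> R -> R) (x y : R) : R := dx (dx f) x y + dy (dy f) x y.

(** This is [f^2 * Laplacian (log f)] where [f > 0]; avoiding the logarithm
    keeps the expression polynomial in the derivatives of [f]. *)
Definition log_lap (f : R -> R -> R) (x y : R) : R :=
  f x y * lap f x y - (dx f x y ^ 2 + dy f x y ^ 2).

(** The Cauchy-Riemann equations for [P + i Q]; second derivatives of [P] and
    [Q] are not assumed to exist. *)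
Definition holo (P Q : R -> R -> R) : Prop :=
  C1 P /\ C1 Q /\ forall x y, dx P x y = dy Q x y /\ dy P x y = - dx Q x y.

Lemma continuity_2d_comp (f g h : R -> R -> R) (x y : R) :
  continuity_2d_pt f (g x y) (h x y) ->
  continuity_2d_pt g x y -> continuity_2d_pt h x y ->
  continuity_2d_pt (fun u v => f (g u v) (h u v)) x y.
Proof.
  intros Hf Hg Hh eps.
  destruct (Hf eps) as [del Hdel].
  generalize (locally_2d_and _ _ _ _ (Hg del) (Hh del)).
  apply locally_2d_impl, locally_2d_forall.
  intros u v [H1 H2]; now apply Hdel.
Qed.

Lemma continuous_curve (f : R -> R -> R) (g h : R -> R) (t : R) :
  continuity_2d_pt f (g t) (h t) -> continuous g t -> continuous h t ->
  continuous (fun s => f (g s) (h s)) t.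
Proof.
  intros Hf Hg Hh.
  apply (continuous_comp_2 g h f); try assumption.
  now apply continuity_2d_pt_filterlim in Hf.
Qed.

Lemma continuity_2d_2 (g : R -> R) (x y : R) :
  continuous g y -> continuity_2d_pt (fun _ v => g v) x y.
Proof.
  intros Hg.
  apply (continuity_1d_2d_pt_comp g (fun _ v => v)).
  - now apply continuity_pt_filterlim.
  - apply continuity_2d_pt_id2.
Qed.

Lemma C1_differentiable (f : R -> R -> R) (x y : R) :
  C1 f -> differentiable_pt_lim f x y (dx f x y) (dy f x y).
Proof.
  intros [Hd [Hx Hy]].
  apply filterdiff_differentiable_pt_lim.
  apply (is_derive_filterdiff f x y (dx f) (dy f x y)).
  - apply filter_forall; intros [u v]; simpl.
    apply Derive_correct, (Hd u v).
  - apply Derive_correct, (Hd x y).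
  - now apply continuity_2d_pt_filterlim.
Qed.

Lemma C1_C0 (f : R -> R -> R) : C1 f -> C0 f.
Proof.
  intros Hf x y. apply differentiable_continuity_pt.
  exists (dx f x y), (dy f x y). now apply C1_differentiable.
Qed.

Lemma C1_curve (f : R -> R -> R) (g h : R -> R) (t lg lh : R) :
  C1 f -> is_derive g t lg -> is_derive h t lh ->
  is_derive (fun s => f (g s) (h s)) t
    (dx f (g t) (h t) * lg + dy f (g t) (h t) * lh).
Proof.
  intros Hf Hg Hh. apply is_derive_Reals.
  apply derivable_pt_lim_comp_2d; try now apply is_derive_Reals.
  now apply C1_differentiable.
Qed.

Lemma dx_eq (f g : R -> R -> R) :
  (forall x y, is_derive (fun s => f s y) x (g x y)) -> dx f = g.
Proof.
  intros H; do 2 (apply functional_extensionality; intro).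
  now apply is_derive_unique.
Qed.

Lemma dy_eq (f g : R -> R -> R) :
  (forall x y, is_derive (fun t => f x t) y (g x y)) -> dy f = g.
Proof.
  intros H; do 2 (apply functional_extensionality; intro).
  now apply is_derive_unique.
Qed.

Lemma C1_intro (f fx fy : R -> R -> R) :
  (forall x y, is_derive (fun s => f s y) x (fx x y)) ->
  (forall x y, is_derive (fun t => f x t) y (fy x y)) ->
  C0 fx -> C0 fy -> C1 f.
Proof.
  intros H1 H2 H3 H4. split; [|split].
  - intros x y; split; [now exists (fx x y) | now exists (fy x y)].
  - now rewrite (dx_eq f fx).
  - now rewrite (dy_eq f fy).
Qed.

Lemma C0_plus f g : C0 f -> C0 g -> C0 (fun x y => f x y + g x y).
Proof. intros Hf Hg x y; now apply continuity_2d_pt_plus. Qed.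
Lemma C0_mult f g : C0 f -> C0 g -> C0 (fun x y => f x y * g x y).
Proof. intros Hf Hg x y; now apply continuity_2d_pt_mult. Qed.

Lemma C1_dx f x y : C1 f -> is_derive (fun s => f s y) x (dx f x y).
Proof. intros [H _]; apply Derive_correct, (H x y). Qed.
Lemma C1_dy f x y : C1 f -> is_derive (fun t => f x t) y (dy f x y).
Proof. intros [H _]; apply Derive_correct, (H x y). Qed.

Lemma dx_plus f g : C1 f -> C1 g ->
  dx (fun x y => f x y + g x y) = fun x y => dx f x y + dx g x y.
Proof.
  intros Hf Hg; apply dx_eq; intros x y.
  apply (is_derive_plus (fun s => f s y) (fun s => g s y)); now apply C1_dx.
Qed.
Lemma dy_plus f g : C1 f -> C1 g ->
  dy (fun x y => f x y + g x y) = fun x y => dy f x y + dy g x y.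
Proof.
  intros Hf Hg; apply dy_eq; intros x y.
  apply (is_derive_plus (f x) (g x)); now apply C1_dy.
Qed.
Lemma dx_mult f g : C1 f -> C1 g ->
  dx (fun x y => f x y * g x y) = fun x y => dx f x y * g x y + f x y * dx g x y.
Proof.
  intros Hf Hg; apply dx_eq; intros x y.
  apply (is_derive_mult (fun s => f s y) (fun s => g s y));
    try now apply C1_dx. intros; apply Rmult_comm.
Qed.
Lemma dy_mult f g : C1 f -> C1 g ->
  dy (fun x y => f x y * g x y) = fun x y => dy f x y * g x y + f x y * dy g x y.
Proof.
  intros Hf Hg; apply dy_eq; intros x y.
  apply (is_derive_mult (f x) (g x));
    try now apply C1_dy. intros; apply Rmult_comm.
Qed.

Lemma C1_plus f g : C1 f -> C1 g -> C1 (fun x y => f x y + g x y).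
Proof.
  intros Hf Hg; pose proof Hf as [f0 [f1 f2]]; pose proof Hg as [g0 [g1 g2]].
  split; [|split].
  - intros x y; destruct (f0 x y), (g0 x y); split.
    + now apply (ex_derive_plus (fun s => f s y) (fun s => g s y)).
    + now apply (ex_derive_plus (f x) (g x)).
  - rewrite dx_plus by assumption; now apply C0_plus.
  - rewrite dy_plus by assumption; now apply C0_plus.
Qed.
Lemma C1_mult f g : C1 f -> C1 g -> C1 (fun x y => f x y * g x y).
Proof.
  intros Hf Hg; pose proof Hf as [f0 [f1 f2]]; pose proof Hg as [g0 [g1 g2]].
  apply C1_intro with (fun x y => dx f x y * g x y + f x y * dx g x y)
    (fun x y => dy f x y * g x y + f x y * dy g x y).
  - intros x y. apply (is_derive_mult (fun s => f s y) (fun s => g s y));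
    try now apply C1_dx. intros; apply Rmult_comm.
  - intros x y. apply (is_derive_mult (f x) (g x));
    try now apply C1_dy. intros; apply Rmult_comm.
  - apply C0_plus; apply C0_mult; auto using C1_C0.
  - apply C0_plus; apply C0_mult; auto using C1_C0.
Qed.

Lemma C0_const c : C0 (fun _ _ => c).
Proof. intros x y; apply continuity_2d_pt_const. Qed.
Lemma dx_const c : dx (fun _ _ => c) = fun _ _ => 0.
Proof. apply dx_eq; intros; auto_derive; auto. Qed.
Lemma dy_const c : dy (fun _ _ => c) = fun _ _ => 0.
Proof. apply dy_eq; intros; auto_derive; auto. Qed.
Lemma C1_const c : C1 (fun _ _ => c).
Proof.
  apply C1_intro with (fun _ _ => 0) (fun _ _ => 0); try apply C0_const;
    intros; auto_derive; auto.
Qed.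
Lemma C1_x : C1 (fun x _ => x).
Proof.
  apply C1_intro with (fun _ _ => 1) (fun _ _ => 0); try apply C0_const;
    intros; auto_derive; auto.
Qed.
Lemma C1_y : C1 (fun _ y => y).
Proof.
  apply C1_intro with (fun _ _ => 0) (fun _ _ => 1); try apply C0_const;
    intros; auto_derive; auto.
Qed.

Lemma C2_plus f g : C2 f -> C2 g -> C2 (fun x y => f x y + g x y).
Proof.
  intros [f0 [f1 f2]] [g0 [g1 g2]]; split; [|split].
  - now apply C1_plus.
  - rewrite dx_plus by assumption; now apply C1_plus.
  - rewrite dy_plus by assumption; now apply C1_plus.
Qed.
Lemma C2_mult f g : C2 f -> C2 g -> C2 (fun x y => f x y * g x y).
Proof.
  intros [f0 [f1 f2]] [g0 [g1 g2]]; split; [|split].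
  - now apply C1_mult.
  - rewrite dx_mult by assumption; apply C1_plus; now apply C1_mult.
  - rewrite dy_mult by assumption; apply C1_plus; now apply C1_mult.
Qed.
Lemma C2_const c : C2 (fun _ _ => c).
Proof.
  split; [|split]; rewrite ?dx_const, ?dy_const; apply C1_const.
Qed.
Lemma C2_x : C2 (fun x _ => x).
Proof.
  split; [apply C1_x|split].
  - replace (dx _) with (fun _ _ : R => 1); [apply C1_const|].
    symmetry; apply dx_eq; intros; auto_derive; auto.
  - replace (dy _) with (fun _ _ : R => 0); [apply C1_const|].
    symmetry; apply dy_eq; intros; auto_derive; auto.
Qed.
Lemma C2_y : C2 (fun _ y => y).
Proof.
  split; [apply C1_y|split].
  - replace (dx _) with (fun _ _ : R => 0); [apply C1_const|].
    symmetry; apply dx_eq; intros; auto_derive; auto.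
  - replace (dy _) with (fun _ _ : R => 1); [apply C1_const|].
    symmetry; apply dy_eq; intros; auto_derive; auto.
Qed.

(** Solves regularity goals for expressions built with sums and products only;
    differences below are therefore written with a factor [-1]. *)
Ltac smooth := repeat first
  [ assumption
  | simple apply C0_plus | simple apply C0_mult | simple apply C0_const
  | simple apply C1_plus | simple apply C1_mult
  | simple apply C1_const | simple apply C1_x | simple apply C1_y
  | simple apply C2_plus | simple apply C2_mult
  | simple apply C2_const | simple apply C2_x | simple apply C2_y ].

(** The logarithm turns the product into a sum. *)
Lemma log_lap_mult f g x y : C2 f -> C2 g ->
  log_lap (fun x y => f x y * g x y) x y
  = g x y ^ 2 * log_lap f x y + f x y ^ 2 * log_lap g x y.
Proof.
  intros [f0 [f1 f2]] [g0 [g1 g2]]. unfold log_lap, lap.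
  rewrite dx_mult, dy_mult by assumption.
  rewrite dx_plus, dy_plus by now apply C1_mult.
  rewrite !dx_mult, !dy_mult by assumption. ring.
Qed.

Lemma holo_mult P Q P' Q' : holo P Q -> holo P' Q' ->
  holo (fun x y => P x y * P' x y + (-1) * (Q x y * Q' x y))
       (fun x y => P x y * Q' x y + Q x y * P' x y).
Proof.
  intros [p [q H]] [p' [q' H']].
  split; [|split].
  - smooth.
  - smooth.
  - intros x y.
    rewrite !dx_plus, !dy_plus
      by smooth.
    rewrite !dx_mult, !dy_mult
      by smooth.
    rewrite !dx_const, !dy_const.
    destruct (H x y) as [-> ->], (H' x y) as [-> ->].
    split; ring.
Qed.

(** * Mean value property with first derivatives only *)

(** The derivative of the circular mean with respect to the radius is the mean
    of the radial derivative of [P].  By the Cauchy-Riemann equations the radial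
    derivative of [P] times the radius is the angular derivative of [Q], and
    [Q] returns to its value after one turn. *)
Lemma holo_mean (P Q : R -> R -> R) (x0 y0 r : R) :
  holo P Q -> 0 < r ->
  RInt (fun t => P (x0 + r * cos t) (y0 + r * sin t)) 0 (2 * PI)
  = 2 * PI * P x0 y0.
Proof.
  intros [p [q cr]] Hr.
  set (K := fun s t => dx P (x0 + s * cos t) (y0 + s * sin t) * cos t
                       + dy P (x0 + s * cos t) (y0 + s * sin t) * sin t).
  set (I := fun s => RInt (fun t => P (x0 + s * cos t) (y0 + s * sin t)) 0 (2 * PI)).
  assert (Ccos : forall s t, continuity_2d_pt (fun s t => x0 + s * cos t) s t).
  { intros s t. apply continuity_2d_pt_plus; [apply continuity_2d_pt_const|].
    apply continuity_2d_pt_mult; [apply continuity_2d_pt_id1|].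
    apply (continuity_2d_2 cos), continuous_cos. }
  assert (Csin : forall s t, continuity_2d_pt (fun s t => y0 + s * sin t) s t).
  { intros s t. apply continuity_2d_pt_plus; [apply continuity_2d_pt_const|].
    apply continuity_2d_pt_mult; [apply continuity_2d_pt_id1|].
    apply (continuity_2d_2 sin), continuous_sin. }
  assert (circ : forall f, C0 f -> forall s t,
    continuity_2d_pt (fun s t => f (x0 + s * cos t) (y0 + s * sin t)) s t).
  { intros f Hf s t. now apply (continuity_2d_comp f (fun s t => x0 + s * cos t)
      (fun s t => y0 + s * sin t)). }
  assert (slice : forall f : R -> R -> R, C0 f -> forall s t, continuous (f s) t).
  { intros f Hf s t. apply (continuous_curve f (fun _ => s) (fun t => t)).
    - apply Hf. - apply continuous_const. - apply continuous_id. }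
  assert (CK : C0 K).
  { intros s t. apply continuity_2d_pt_plus; apply continuity_2d_pt_mult.
    - apply circ, p.
    - apply (continuity_2d_2 cos), continuous_cos.
    - apply circ, p.
    - apply (continuity_2d_2 sin), continuous_sin. }
  assert (dK : forall s t,
    is_derive (fun s => P (x0 + s * cos t) (y0 + s * sin t)) s (K s t)).
  { intros s t. apply (C1_curve P (fun s => x0 + s * cos t) (fun s => y0 + s * sin t)).
    - assumption.
    - auto_derive; [exact Logic.I | ring].
    - auto_derive; [exact Logic.I | ring]. }
  assert (EK : (fun u v => Derive (fun z => P (x0 + z * cos v) (y0 + z * sin v)) u) = K).
  { do 2 (apply functional_extensionality; intro). apply is_derive_unique, dK. }
  assert (dI : forall s, is_derive I s (RInt (K s) 0 (2 * PI))).
  { intros s. rewrite <- EK.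
    apply (is_derive_RInt_param (fun s t => P (x0 + s * cos t) (y0 + s * sin t))).
    - apply filter_forall; intros s' t _. eexists; apply dK.
    - intros t _. rewrite EK. apply CK.
    - apply filter_forall; intros s'. apply (ex_RInt_continuous (V := R_CompleteNormedModule));
        intros t _.
      apply (slice (fun s t => P (x0 + s * cos t) (y0 + s * sin t))).
      intros ? ?; apply circ. now apply C1_C0. }
  (* The angular derivative of [Q] is [s * K s]. *)
  assert (K0 : forall s, s <> 0 -> RInt (K s) 0 (2 * PI) = 0).
  { intros s Hs.
    assert (is_RInt (fun t => s * K s t) 0 (2 * PI)
      (minus (Q (x0 + s * cos (2 * PI)) (y0 + s * sin (2 * PI)))
             (Q (x0 + s * cos 0) (y0 + s * sin 0)))) as HI.
    { apply (is_RInt_derive (V := R_CompleteNormedModule)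
        (fun t => Q (x0 + s * cos t) (y0 + s * sin t))).
      - intros t _.
        replace (s * K s t) with
          (dx Q (x0 + s * cos t) (y0 + s * sin t) * (- s * sin t)
           + dy Q (x0 + s * cos t) (y0 + s * sin t) * (s * cos t)).
        + apply (C1_curve Q (fun t => x0 + s * cos t) (fun t => y0 + s * sin t)).
          * assumption.
          * auto_derive; [exact Logic.I | ring].
          * auto_derive; [exact Logic.I | ring].
        + unfold K. destruct (cr (x0 + s * cos t) (y0 + s * sin t)) as [-> ->]. ring.
      - intros t _. apply (slice (fun s t => s * K s t)).
        intros u v; apply continuity_2d_pt_mult; [apply continuity_2d_pt_id1 | apply CK]. }
    rewrite cos_2PI, sin_2PI, cos_0, sin_0, minus_eq_zero in HI.
    apply (is_RInt_unique (V := R_CompleteNormedModule)) in HI.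
    assert (RInt (fun t => s * K s t) 0 (2 * PI) = s * RInt (K s) 0 (2 * PI)) as E.
    { apply (RInt_scal (V := R_CompleteNormedModule) (K s)).
      apply (ex_RInt_continuous (V := R_CompleteNormedModule));
        intros t _. now apply slice. }
    rewrite E in HI. change zero with 0 in HI.
    destruct (Rmult_integral _ _ HI); [contradiction | assumption]. }
  destruct (MVT_cor2 I (fun s => RInt (K s) 0 (2 * PI)) 0 r Hr) as [c [Hc c0]].
  { intros c _. apply is_derive_Reals, dI. }
  rewrite K0 in Hc by lra.
  change (I r = 2 * PI * P x0 y0).
  replace (I r) with (I 0) by lra. unfold I.
  rewrite (RInt_ext _ (fun _ => P x0 y0)).
  - rewrite RInt_const. unfold scal; simpl; unfold mult; simpl. ring.
  - intros t _. now rewrite !Rmult_0_l, !Rplus_0_r.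
Qed.

Lemma holo_max (P Q : R -> R -> R) (x0 y0 r : R) :
  holo P Q -> 0 < r ->
  ~ (forall t, P (x0 + r * cos t) (y0 + r * sin t) < P x0 y0).
Proof.
  intros H Hr Hlt. pose proof PI_RGT_0.
  apply (Rlt_irrefl (2 * PI * P x0 y0)).
  rewrite <- (holo_mean P Q x0 y0 r) at 1 by assumption.
  replace (2 * PI * P x0 y0) with (RInt (fun _ => P x0 y0) 0 (2 * PI)).
  - apply RInt_lt.
    + lra.
    + intros; apply continuous_const.
    + intros t _. apply (continuous_curve P (fun t => x0 + r * cos t) (fun t => y0 + r * sin t)).
      * apply C1_C0, H.
      * apply (ex_derive_continuous (fun t => x0 + r * cos t)). auto_derive; auto.
      * apply (ex_derive_continuous (fun t => y0 + r * sin t)). auto_derive; auto.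
    + intros; apply Hlt.
  - rewrite RInt_const. unfold scal; simpl; unfold mult; simpl. ring.
Qed.

(** * Maximum principle for a holomorphic function times a weight *)

(** Along each segment from the base point the second derivative of [D] stays
    close to [l] times the squared length, and [D] starts with value and slope
    zero.  The estimate is uniform in the direction of the segment. *)
Lemma isotropic_min (D : R -> R -> R) (x0 y0 l : R) :
  C2 D -> D x0 y0 = 0 -> dx D x0 y0 = 0 -> dy D x0 y0 = 0 -> 0 < l ->
  dx (dx D) x0 y0 = l -> dy (dy D) x0 y0 = l ->
  dy (dx D) x0 y0 + dx (dy D) x0 y0 = 0 ->
  locally_2d (fun x y => 0 < (x - x0) ^ 2 + (y - y0) ^ 2 -> 0 < D x y) x0 y0.
Proof.
  intros [D0 [Dx Dy]] E0 Ex Ey Hl Exx Eyy Exy.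
  assert (Hl4 : 0 < l / 4) by lra.
  (* With all four second derivatives within [l / 4] of their values at the base
     point, the Hessian form is at least [l / 2] times the squared length. *)
  set (e := mkposreal _ Hl4).
  pose proof Dx as [_ [Cxx Cxy]]; pose proof Dy as [_ [Cyx Cyy]].
  destruct (locally_2d_and _ _ _ _
    (locally_2d_and _ _ _ _ (Cxx x0 y0 e) (Cyy x0 y0 e))
    (locally_2d_and _ _ _ _ (Cxy x0 y0 e) (Cyx x0 y0 e))) as [del Hdel].
  exists del. intros x y Hx Hy Hxy.
  set (xi := x - x0) in *; set (eta := y - y0) in *.
  set (phi1 := fun s => dx D (x0 + s * xi) (y0 + s * eta) * xi
                       + dy D (x0 + s * xi) (y0 + s * eta) * eta).
  assert (Lx : forall s, is_derive (fun s => x0 + s * xi) s xi).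
  { intros s; auto_derive; [exact I | ring]. }
  assert (Ly : forall s, is_derive (fun s => y0 + s * eta) s eta).
  { intros s; auto_derive; [exact I | ring]. }
  assert (d0 : forall s, is_derive (fun s => D (x0 + s * xi) (y0 + s * eta)) s (phi1 s)).
  { intros s. now apply (C1_curve D (fun s => x0 + s * xi) (fun s => y0 + s * eta)). }
  assert (d1 : forall s, is_derive phi1 s
     ((dx (dx D) (x0 + s * xi) (y0 + s * eta) * xi
        + dy (dx D) (x0 + s * xi) (y0 + s * eta) * eta) * xi
      + (dx (dy D) (x0 + s * xi) (y0 + s * eta) * xi
        + dy (dy D) (x0 + s * xi) (y0 + s * eta) * eta) * eta)).
  { intros s. apply (is_derive_plus (fun s => _ * xi) (fun s => _ * eta)).
    - apply (is_derive_ext (fun s => scal xi (dx D (x0 + s * xi) (y0 + s * eta)))).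
      { intros; apply Rmult_comm. }
      rewrite Rmult_comm. apply (is_derive_scal (fun s => dx D (x0 + s * xi) (y0 + s * eta))).
      now apply (C1_curve (dx D) (fun s => x0 + s * xi) (fun s => y0 + s * eta)).
    - apply (is_derive_ext (fun s => scal eta (dy D (x0 + s * xi) (y0 + s * eta)))).
      { intros; apply Rmult_comm. }
      rewrite Rmult_comm. apply (is_derive_scal (fun s => dy D (x0 + s * xi) (y0 + s * eta))).
      now apply (C1_curve (dy D) (fun s => x0 + s * xi) (fun s => y0 + s * eta)). }
  destruct (MVT_cor2 (fun s => D (x0 + s * xi) (y0 + s * eta)) phi1 0 1) as [c [Hc c01]].
  { lra. } { intros; apply is_derive_Reals, d0. }
  destruct (MVT_cor2 phi1 (fun s =>
      (dx (dx D) (x0 + s * xi) (y0 + s * eta) * xi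
        + dy (dx D) (x0 + s * xi) (y0 + s * eta) * eta) * xi
      + (dx (dy D) (x0 + s * xi) (y0 + s * eta) * xi
        + dy (dy D) (x0 + s * xi) (y0 + s * eta) * eta) * eta) 0 c) as [c' [Hc' c'01]].
  { lra. } { intros; apply is_derive_Reals, d1. }
  assert (P0 : phi1 0 = 0).
  { unfold phi1. rewrite !Rmult_0_l, !Rplus_0_r, Ex, Ey. ring. }
  rewrite P0 in Hc'.
  rewrite !Rmult_0_l, !Rplus_0_r, E0, !Rmult_1_l in Hc.
  replace (x0 + xi) with x in Hc by (unfold xi; ring).
  replace (y0 + eta) with y in Hc by (unfold eta; ring).
  assert (shrink : forall z z0, Rabs z < del -> Rabs (z0 + c' * z - z0) < del).
  { intros z z0 Hz. replace (z0 + c' * z - z0) with (c' * z) by ring.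
    rewrite Rabs_mult, (Rabs_pos_eq c') by lra.
    apply Rle_lt_trans with (1 * Rabs z); [|lra].
    apply Rmult_le_compat_r; [apply Rabs_pos | lra]. }
  destruct (Hdel (x0 + c' * xi) (y0 + c' * eta)) as [[H1 H2] [H3 H4]]; try now apply shrink.
  rewrite Exx in H1; rewrite Eyy in H2. simpl in H1, H2, H3, H4.
  apply Rabs_def2 in H1; apply Rabs_def2 in H2; apply Rabs_def2 in H3; apply Rabs_def2 in H4.
  set (A := dx (dx D) (x0 + c' * xi) (y0 + c' * eta)) in *.
  set (B := dy (dx D) (x0 + c' * xi) (y0 + c' * eta)) in *.
  set (C := dx (dy D) (x0 + c' * xi) (y0 + c' * eta)) in *.
  set (E := dy (dy D) (x0 + c' * xi) (y0 + c' * eta)) in *.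
  assert (HQ : 0 < (A * xi + B * eta) * xi + (C * xi + E * eta) * eta).
  { assert (HBC : Rabs (B + C) <= l / 2) by (apply Rabs_le; lra).
    assert (Hp : Rabs ((B + C) * (xi * eta)) <= l / 2 * ((xi ^ 2 + eta ^ 2) / 2)).
    { rewrite Rabs_mult. apply Rmult_le_compat; try apply Rabs_pos; [assumption|].
      pose proof (pow2_ge_0 (xi + eta)); pose proof (pow2_ge_0 (xi - eta)).
      apply Rabs_le; split; lra. }
    apply Rabs_le_between in Hp.
    assert (0 <= xi ^ 2) by apply pow2_ge_0. assert (0 <= eta ^ 2) by apply pow2_ge_0.
    assert (3 * l / 4 * xi ^ 2 <= A * xi ^ 2) by (apply Rmult_le_compat_r; lra).
    assert (3 * l / 4 * eta ^ 2 <= E * eta ^ 2) by (apply Rmult_le_compat_r; lra).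
    assert (0 < l / 2 * (xi ^ 2 + eta ^ 2)) by (apply Rmult_lt_0_compat; lra).
    nra. }
  assert (0 < phi1 c).
  { rewrite <- (Rminus_0_r (phi1 c)), Hc'. apply Rmult_lt_0_compat; lra. }
  lra.
Qed.

Lemma dx_lin f g c : C1 f -> C1 g ->
  dx (fun x y => f x y + c * g x y) = fun x y => dx f x y + c * dx g x y.
Proof.
  intros Hf Hg. rewrite dx_plus, dx_mult, dx_const by smooth.
  do 2 (apply functional_extensionality; intro). ring.
Qed.
Lemma dy_lin f g c : C1 f -> C1 g ->
  dy (fun x y => f x y + c * g x y) = fun x y => dy f x y + c * dy g x y.
Proof.
  intros Hf Hg. rewrite dy_plus, dy_mult, dy_const by smooth.
  do 2 (apply functional_extensionality; intro). ring.
Qed.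

Lemma holo_const a b : holo (fun _ _ => a) (fun _ _ => b).
Proof.
  split; [|split]; smooth. intros x y. rewrite !dx_const, !dy_const. split; ring.
Qed.

(** [M + i N = 1 + alpha zeta + beta zeta^2] with [zeta] the complex coordinate
    centred at the base point.  The choice of [alpha] matches the gradient of
    [W] with that of [W x0 y0 * |M + i N|^2], and [beta] matches the trace-free
    part of the Hessian.  Since [log |M + i N|] is harmonic, the remaining
    isotropic part of the difference of the Hessians is
    [log_lap W x0 y0 / (2 * W x0 y0)] times the identity, which is positive. *)
Lemma taylor_minorant (W : R -> R -> R) (x0 y0 : R) :
  C2 W -> 0 < W x0 y0 -> 0 < log_lap W x0 y0 ->
  exists M N, holo M N /\ M x0 y0 = 1 /\ N x0 y0 = 0 /\
    locally_2d (fun x y => 0 < (x - x0) ^ 2 + (y - y0) ^ 2 ->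
      W x0 y0 * (M x y ^ 2 + N x y ^ 2) < W x y) x0 y0.
Proof.
  intros HW W0 HL.
  set (w := W x0 y0) in *.
  set (a1 := dx W x0 y0 / (2 * w)).
  set (a2 := - dy W x0 y0 / (2 * w)).
  set (b1 := (dx (dx W) x0 y0 - dy (dy W) x0 y0) / (8 * w)).
  set (b2 := - (dy (dx W) x0 y0 + dx (dy W) x0 y0) / (8 * w)).
  set (M := fun x y => 1 + a1 * (x + - x0) + - a2 * (y + - y0)
    + b1 * ((x + - x0) * (x + - x0) + -1 * ((y + - y0) * (y + - y0)))
    + - (2 * b2) * ((x + - x0) * (y + - y0))).
  set (N := fun x y => a2 * (x + - x0) + a1 * (y + - y0)
    + b2 * ((x + - x0) * (x + - x0) + -1 * ((y + - y0) * (y + - y0)))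
    + 2 * b1 * ((x + - x0) * (y + - y0))).
  assert (SM : C2 M) by (unfold M; smooth).
  assert (SN : C2 N) by (unfold N; smooth).
  set (mx := fun x y => a1 + 2 * b1 * (x - x0) - 2 * b2 * (y - y0)).
  set (nx := fun x y => a2 + 2 * b2 * (x - x0) + 2 * b1 * (y - y0)).
  assert (Mx : dx M = mx).
  { apply dx_eq; intros; unfold M, mx; auto_derive; [exact I | ring]. }
  assert (My : dy M = fun x y => - nx x y).
  { apply dy_eq; intros; unfold M, nx; auto_derive; [exact I | ring]. }
  assert (Nx : dx N = nx).
  { apply dx_eq; intros; unfold N, nx; auto_derive; [exact I | ring]. }
  assert (Ny : dy N = mx).
  { apply dy_eq; intros; unfold N, mx; auto_derive; [exact I | ring]. }
  assert (M0 : M x0 y0 = 1) by (unfold M; ring).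
  assert (N0 : N x0 y0 = 0) by (unfold N; ring).
  exists M, N. split; [|split; [|split]]; try assumption.
  { split; [apply SM|split; [apply SN|]]. intros x y.
    rewrite Mx, My, Nx, Ny. split; ring. }
  set (E := fun x y => M x y * M x y + N x y * N x y).
  assert (SE : C2 E) by (unfold E; smooth).
  assert (Ex : dx E = fun x y => 2 * (M x y * mx x y + N x y * nx x y)).
  { destruct SM, SN. unfold E. rewrite dx_plus, !dx_mult, Mx, Nx by smooth.
    do 2 (apply functional_extensionality; intro). ring. }
  assert (Ey : dy E = fun x y => 2 * (N x y * mx x y - M x y * nx x y)).
  { destruct SM, SN. unfold E. rewrite dy_plus, !dy_mult, My, Ny by smooth.
    do 2 (apply functional_extensionality; intro). ring. }
  assert (Exx : dx (dx E) x0 y0 = 2 * (a1 ^ 2 + a2 ^ 2) + 4 * b1).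
  { rewrite Ex. apply is_derive_unique. unfold M, N, mx, nx. auto_derive; [exact I | ring]. }
  assert (Exy : dy (dx E) x0 y0 = - 4 * b2).
  { rewrite Ex. apply is_derive_unique. unfold M, N, mx, nx. auto_derive; [exact I | ring]. }
  assert (Eyx : dx (dy E) x0 y0 = - 4 * b2).
  { rewrite Ey. apply is_derive_unique. unfold M, N, mx, nx. auto_derive; [exact I | ring]. }
  assert (Eyy : dy (dy E) x0 y0 = 2 * (a1 ^ 2 + a2 ^ 2) - 4 * b1).
  { rewrite Ey. apply is_derive_unique. unfold M, N, mx, nx. auto_derive; [exact I | ring]. }
  assert (Ex0 : dx E x0 y0 = 2 * a1).
  { rewrite Ex, M0, N0. unfold mx; ring. }
  assert (Ey0 : dy E x0 y0 = - 2 * a2).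
  { rewrite Ey, M0, N0. unfold nx; ring. }
  assert (E0 : E x0 y0 = 1) by (unfold E; rewrite M0, N0; ring).
  assert (HE : forall x y, E x y = M x y * M x y + N x y * N x y) by reflexivity.
  clearbody E. clear mx nx Mx My Nx Ny Ex Ey.
  assert (HD : locally_2d (fun x y => 0 < (x - x0) ^ 2 + (y - y0) ^ 2 ->
    0 < W x y + - w * E x y) x0 y0).
  { destruct HW as [HW [HWx HWy]], SE as [SE [SEx SEy]].
    apply (isotropic_min _ x0 y0 (log_lap W x0 y0 / (2 * w)));
      rewrite ?dx_lin, ?dy_lin by assumption;
      rewrite ?dx_lin, ?dy_lin by assumption.
    - split; [|split]; rewrite ?dx_lin, ?dy_lin by assumption; smooth.
    - rewrite E0. fold w. ring.
    - rewrite Ex0. unfold a1. field. lra.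
    - rewrite Ey0. unfold a2. field. lra.
    - apply Rdiv_lt_0_compat; lra.
    - rewrite Exx. unfold a1, a2, b1, log_lap, lap. fold w. field. lra.
    - rewrite Eyy. unfold a1, a2, b1, log_lap, lap. fold w. field. lra.
    - rewrite Exy, Eyx. unfold b2. field. lra. }
  revert HD. apply locally_2d_impl, locally_2d_forall.
  intros x y H Hxy. specialize (H Hxy).
  replace (M x y ^ 2 + N x y ^ 2) with (E x y); [lra|].
  rewrite HE. ring.
Qed.

(** Otherwise the product of [P + i Q] with the polynomial of [taylor_minorant]
    is strictly smaller in modulus on small circles than at their centre.
    Multiplying it by the conjugate of [P + i Q] at the centre makes its value
    there real and positive, so the real part has a strict maximum. *)
Lemma no_local_max (W P Q : R -> R -> R) (x0 y0 : R) :
  C2 W -> holo P Q -> 0 < W x0 y0 -> 0 < log_lap W x0 y0 ->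
  locally_2d (fun x y => (P x y ^ 2 + Q x y ^ 2) * W x y
                         <= (P x0 y0 ^ 2 + Q x0 y0 ^ 2) * W x0 y0) x0 y0 ->
  P x0 y0 ^ 2 + Q x0 y0 ^ 2 = 0.
Proof.
  intros HW HPQ W0 HL Hmax.
  destruct (taylor_minorant W x0 y0 HW W0 HL) as [M [N [HMN [M0 [N0 Hmin]]]]].
  set (p := P x0 y0) in *; set (q := Q x0 y0) in *; set (w := W x0 y0) in *.
  destruct (Rle_lt_or_eq_dec 0 (p ^ 2 + q ^ 2)) as [Hn|Hn];
    [pose proof (pow2_ge_0 p); pose proof (pow2_ge_0 q); lra | exfalso | now symmetry].
  destruct (locally_2d_and _ _ _ _ Hmax Hmin) as [del Hdel].
  set (r := del / 2).
  assert (Hr : 0 < r) by (unfold r; pose proof (cond_pos del); lra).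
  pose proof (holo_mult _ _ _ _ (holo_const p (- q)) (holo_mult _ _ _ _ HPQ HMN)) as HH.
  cbv beta in HH.
  refine (holo_max _ _ x0 y0 r HH Hr _). intros t.
  rewrite M0, N0. fold p q.
  set (x := x0 + r * cos t); set (y := y0 + r * sin t).
  assert (small : forall z z0 c, -1 <= c <= 1 -> z = z0 + r * c -> Rabs (z - z0) < del).
  { intros z z0 c Hc ->. replace (z0 + r * c - z0) with (r * c) by ring.
    apply Rabs_def1; unfold r in *; pose proof (cond_pos del); nra. }
  destruct (Hdel x y) as [H1 H2].
  { apply (small x x0 (cos t)); [apply COS_bound | reflexivity]. }
  { apply (small y y0 (sin t)); [apply SIN_bound | reflexivity]. }
  assert (Hxy : 0 < (x - x0) ^ 2 + (y - y0) ^ 2).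
  { replace ((x - x0) ^ 2 + (y - y0) ^ 2) with (r ^ 2 * ((sin t)² + (cos t)²))
      by (unfold x, y, Rsqr; ring).
    rewrite sin2_cos2. assert (0 < r ^ 2) by now apply pow_lt. lra. }
  specialize (H2 Hxy).
  set (P1 := P x y) in *; set (Q1 := Q x y) in *.
  set (M1 := M x y) in *; set (N1 := N x y) in *. set (w1 := W x y) in *.
  set (S := P1 * M1 + -1 * (Q1 * N1)). set (T := P1 * N1 + Q1 * M1).
  set (n := p ^ 2 + q ^ 2) in *.
  replace (p * (p * 1 + -1 * (q * 0)) + -1 * (- q * (p * 0 + q * 1))) with n
    by (unfold n; ring).
  assert (HST : S ^ 2 + T ^ 2 = (P1 ^ 2 + Q1 ^ 2) * (M1 ^ 2 + N1 ^ 2))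
    by (unfold S, T; ring).
  assert (Hlt : S ^ 2 + T ^ 2 < n).
  { rewrite HST. pose proof (pow2_ge_0 P1); pose proof (pow2_ge_0 Q1).
    destruct (Req_dec (P1 ^ 2 + Q1 ^ 2) 0) as [-> | Hne]; [lra|].
    apply Rmult_lt_reg_r with w; [assumption|].
    apply Rlt_le_trans with ((P1 ^ 2 + Q1 ^ 2) * w1); [|assumption].
    rewrite Rmult_assoc, (Rmult_comm _ w). apply Rmult_lt_compat_l; lra. }
  (* Cauchy-Schwarz for [(p, q)] and [(S, T)]: the real part is at most the modulus. *)
  assert (Hcs : (p * S + q * T) ^ 2 <= n * (S ^ 2 + T ^ 2)).
  { pose proof (pow2_ge_0 (p * T - q * S)). unfold n. lra. }
  assert (Hsq : (p * S + q * T) ^ 2 < n ^ 2).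
  { apply Rle_lt_trans with (1 := Hcs). replace (n ^ 2) with (n * n) by ring.
    now apply Rmult_lt_compat_l. }
  replace (p * S + -1 * (- q * T)) with (p * S + q * T) by ring.
  nra.
Qed.

(** * Continuous functions on a rectangle attain their maximum *)

(** In the compactness statement the radius around [(u, v)] is chosen at most
    [1 / (1 + |F u v|)].  A uniform positive lower bound on the radii in use
    then bounds [|F u v|] at the centres. *)
Lemma box_bounded (F : R -> R -> R) (a b c d : R) :
  (forall x y, a <= x <= b -> c <= y <= d -> continuity_2d_pt F x y) ->
  exists m, forall x y, a <= x <= b -> c <= y <= d -> F x y <= m.
Proof.
  intros HF.
  assert (H : forall u v, exists del : posreal, a <= u <= b -> c <= v <= d ->
    del <= / (1 + Rabs (F u v)) /\
    forall x y, Rabs (x - u) < del -> Rabs (y - v) < del -> F x y < F u v + 1).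
  { intros u v.
    destruct (classic (a <= u <= b /\ c <= v <= d)) as [[Hu Hv]|Hno].
    - destruct (HF u v Hu Hv (mkposreal 1 Rlt_0_1)) as [del Hdel].
      assert (Hpos : 0 < / (1 + Rabs (F u v))).
      { apply Rinv_0_lt_compat. pose proof (Rabs_pos (F u v)). lra. }
      assert (Hm : 0 < Rmin del (/ (1 + Rabs (F u v)))).
      { apply Rmin_pos; [apply cond_pos | assumption]. }
      exists (mkposreal _ Hm). intros _ _; simpl. split; [apply Rmin_r|].
      intros x y Hx Hy.
      assert (Hxy : Rabs (F x y - F u v) < 1).
      { apply Hdel; eapply Rlt_le_trans; eauto using Rmin_l. }
      apply Rabs_def2 in Hxy. lra.
    - exists (mkposreal 1 Rlt_0_1). intros Hu Hv. now destruct Hno. }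
  pose (delta := fun u v => proj1_sig (constructive_indefinite_description _ (H u v))).
  destruct (compactness_value_2d a b c d delta) as [eps Heps].
  exists (/ eps). intros x y Hx Hy.
  apply Rnot_lt_le; intros Hlt. apply (Heps x y Hx Hy).
  intros [u [v [Hu [Hv [Hxu [Hyv Hle]]]]]]. unfold delta in *.
  destruct (constructive_indefinite_description _ (H u v)) as [del Hdel]; simpl in *.
  destruct (Hdel Hu Hv) as [H1 H2]. specialize (H2 x y Hxu Hyv).
  pose proof (cond_pos eps) as He. pose proof (Rabs_pos (F u v)).
  assert (1 + Rabs (F u v) <= / eps).
  { rewrite <- (Rinv_inv (1 + Rabs (F u v))).
    apply Rinv_le_contravar; lra. }
  pose proof (Rle_abs (F u v)). lra.
Qed.

(** If the supremum [m] were not attained, [1 / (m - F)] would be continuous,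
    hence bounded, which keeps [F] away from [m]. *)
Lemma box_max (F : R -> R -> R) (a b c d : R) :
  C0 F -> a <= b -> c <= d ->
  exists x0 y0, a <= x0 <= b /\ c <= y0 <= d /\
    forall x y, a <= x <= b -> c <= y <= d -> F x y <= F x0 y0.
Proof.
  intros HF Hab Hcd.
  set (V := fun z => exists x y, a <= x <= b /\ c <= y <= d /\ z = F x y).
  destruct (completeness V) as [m [Hub Hlub]].
  { destruct (box_bounded F a b c d) as [m Hm]; [intros; apply HF|].
    exists m. intros z [x [y [Hx [Hy ->]]]]. now apply Hm. }
  { exists (F a c), a, c. repeat split; lra. }
  apply NNPP; intros Hno.
  assert (Hlt : forall x y, a <= x <= b -> c <= y <= d -> F x y < m).
  { intros x y Hx Hy. destruct (Rle_lt_or_eq_dec (F x y) m) as [|E]; [|assumption|].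
    - apply Hub. now exists x, y.
    - destruct Hno. exists x, y. split; [|split]; try assumption.
      intros x' y' Hx' Hy'. rewrite E. apply Hub. now exists x', y'. }
  destruct (box_bounded (fun x y => / (m - F x y)) a b c d) as [k Hk].
  { intros x y Hx Hy. specialize (Hlt x y Hx Hy). apply continuity_2d_pt_inv; [|lra].
    apply continuity_2d_pt_minus; [apply continuity_2d_pt_const | apply HF]. }
  assert (Hkpos : 0 < k).
  { apply Rlt_le_trans with (/ (m - F a c)); [|apply Hk; lra].
    apply Rinv_0_lt_compat. specialize (Hlt a c). lra. }
  assert (m <= m - / k); [apply Hlub|pose proof (Rinv_0_lt_compat k Hkpos); lra].
  intros z [x [y [Hx [Hy ->]]]].
  specialize (Hlt x y Hx Hy). specialize (Hk x y Hx Hy).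
  assert (/ k <= m - F x y); [|lra].
  rewrite <- (Rinv_inv (m - F x y)). apply Rinv_le_contravar; [|assumption].
  apply Rinv_0_lt_compat; lra.
Qed.

(** * Entire metrics of negative curvature are trivial *)

(** Comparison with the hyperbolic metric of large discs, whose density is a
    multiple of [1 / rho].  At a maximum of [F = |h|^2 a^2 rho^2],
      [log_lap (a * rho) = a^2 * (k * F - 4 * R2)],
    so [no_local_max] forces [k * F <= 4 * R2] there; but [k * F] equals
    [8 * R2] at the centre of the disc by the choice of the squared radius
    [R2]. *)
Lemma pseudometric_trivial (a P Q : R -> R -> R) (k x0 y0 : R) :
  C2 a -> (forall x y, 0 < a x y) -> holo P Q -> 0 < k ->
  (forall x y, log_lap a x y = k * a x y ^ 4 * (P x y ^ 2 + Q x y ^ 2)) ->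
  P x0 y0 ^ 2 + Q x0 y0 ^ 2 = 0.
Proof.
  intros Ca a_pos HPQ Hk Heq.
  set (h := fun x y => P x y ^ 2 + Q x y ^ 2).
  change (h x0 y0 = 0).
  assert (h_nonneg : forall x y, 0 <= h x y).
  { intros x y. unfold h. pose proof (pow2_ge_0 (P x y)); pose proof (pow2_ge_0 (Q x y)). lra. }
  destruct (Rle_lt_or_eq_dec _ _ (h_nonneg x0 y0)) as [h0|]; [exfalso | now symmetry].
  pose proof (a_pos x0 y0) as a0.
  assert (Hden : 0 < k * h x0 y0 * a x0 y0 ^ 2).
  { apply Rmult_lt_0_compat; [now apply Rmult_lt_0_compat | now apply pow_lt]. }
  set (R2 := 8 / (k * h x0 y0 * a x0 y0 ^ 2)).
  assert (HR2 : 0 < R2) by (apply Rdiv_lt_0_compat; lra).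
  set (rho := fun x y => R2 + -1 * ((x + - x0) * (x + - x0) + (y + - y0) * (y + - y0))).
  assert (Crho : C2 rho) by (unfold rho; smooth).
  assert (Lrho : forall x y, log_lap rho x y = - 4 * R2).
  { intros x y. unfold log_lap, lap.
    assert (dx rho = fun x y => -2 * (x - x0)) as ->.
    { apply dx_eq; intros; unfold rho; auto_derive; [exact I | ring]. }
    assert (dy rho = fun x y => -2 * (y - y0)) as ->.
    { apply dy_eq; intros; unfold rho; auto_derive; [exact I | ring]. }
    assert (dx (fun x y => -2 * (x - x0)) = fun _ _ => -2) as ->.
    { apply dx_eq; intros; auto_derive; [exact I | ring]. }
    assert (dy (fun x y => -2 * (y - y0)) = fun _ _ => -2) as ->.
    { apply dy_eq; intros; auto_derive; [exact I | ring]. }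
    unfold rho. ring. }
  set (A := fun x y => a x y * rho x y).
  assert (CA : C2 A) by (unfold A; smooth).
  set (W := fun x y => A x y * A x y).
  assert (CW : C2 W) by (unfold W; smooth).
  pose proof HPQ as [CP [CQ _]].
  (* The factor [rho * |rho|] agrees with [rho^2] inside the disc and is negative
     outside, so a maximum of [F] over a square around the disc lies inside. *)
  set (F := fun x y => (P x y * P x y + Q x y * Q x y) * (a x y * a x y)
                       * (rho x y * Rabs (rho x y))).
  assert (C0rho : C0 rho) by apply C1_C0, Crho.
  assert (CF : C0 F).
  { assert (C0 a) by apply C1_C0, Ca.
    assert (C0 P) by now apply C1_C0. assert (C0 Q) by now apply C1_C0.
    unfold F. smooth.
    intros x y. apply (continuity_1d_2d_pt_comp Rabs); [apply Rcontinuity_abs | apply C0rho]. }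
  assert (F_in : forall x y, 0 <= rho x y -> F x y = h x y * W x y).
  { intros x y Hr. unfold F, h, W, A. rewrite Rabs_pos_eq by assumption. ring. }
  assert (F_out : forall x y, rho x y <= 0 -> F x y <= 0).
  { intros x y Hr.
    replace (F x y) with (h x y * a x y ^ 2 * (rho x y * Rabs (rho x y)))
      by (unfold F, h; ring).
    assert (0 <= h x y * a x y ^ 2) by (apply Rmult_le_pos; [apply h_nonneg | apply pow2_ge_0]).
    assert (0 <= - rho x y * Rabs (rho x y)) by (apply Rmult_le_pos; [lra | apply Rabs_pos]).
    nra. }
  assert (rho0 : rho x0 y0 = R2) by (unfold rho; ring).
  assert (F0 : k * F x0 y0 = 8 * R2).
  { rewrite F_in by lra. unfold W, A. rewrite rho0. unfold R2. field. lra. }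
  destruct (box_max F (x0 - (1 + R2)) (x0 + (1 + R2)) (y0 - (1 + R2)) (y0 + (1 + R2)))
    as [x1 [y1 [Hx1 [Hy1 Hmax]]]]; try lra; [assumption|].
  assert (Hge : 8 * R2 <= k * F x1 y1).
  { rewrite <- F0. apply Rmult_le_compat_l; [lra|]. apply Hmax; lra. }
  assert (rho1 : 0 < rho x1 y1).
  { apply Rnot_le_lt; intros Hle. apply F_out in Hle. nra. }
  pose proof (a_pos x1 y1) as a1.
  assert (A1 : 0 < A x1 y1) by now apply Rmult_lt_0_compat.
  assert (W1 : 0 < W x1 y1) by now apply Rmult_lt_0_compat.
  assert (LA : 0 < log_lap A x1 y1).
  { unfold A. rewrite log_lap_mult, Lrho, Heq by assumption. fold (h x1 y1).
    rewrite F_in in Hge by lra. unfold W, A in Hge.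
    replace (rho x1 y1 ^ 2 * (k * a x1 y1 ^ 4 * h x1 y1) + a x1 y1 ^ 2 * (-4 * R2))
      with (a x1 y1 ^ 2 * (k * (h x1 y1 * (a x1 y1 * rho x1 y1 * (a x1 y1 * rho x1 y1))) - 4 * R2))
      by ring.
    apply Rmult_lt_0_compat; [now apply pow_lt | lra]. }
  assert (LW : 0 < log_lap W x1 y1).
  { unfold W. rewrite log_lap_mult by assumption.
    assert (0 < A x1 y1 ^ 2 * log_lap A x1 y1)
      by (apply Rmult_lt_0_compat; [now apply pow_lt | assumption]). lra. }
  assert (Hh1 : h x1 y1 = 0).
  { apply (no_local_max W P Q x1 y1); try assumption.
    destruct (C0rho x1 y1 (mkposreal _ rho1)) as [del Hdel].
    exists del. intros x y Hx Hy. fold (h x y) (h x1 y1).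
    specialize (Hdel x y Hx Hy). simpl in Hdel. apply Rabs_def2 in Hdel.
    rewrite <- !F_in by lra.
    assert (Hbox : (x - x0) ^ 2 + (y - y0) ^ 2 < R2).
    { assert (0 < rho x y) as Hr by lra. unfold rho in Hr. lra. }
    assert (R2 < (1 + R2) ^ 2) by nra.
    pose proof (pow2_ge_0 (x - x0)); pose proof (pow2_ge_0 (y - y0)).
    assert (Rabs (x - x0) < 1 + R2) as Bx.
    { rewrite <- (Rabs_pos_eq (1 + R2)) by lra. apply Rsqr_lt_abs_0. unfold Rsqr. lra. }
    assert (Rabs (y - y0) < 1 + R2) as By.
    { rewrite <- (Rabs_pos_eq (1 + R2)) by lra. apply Rsqr_lt_abs_0. unfold Rsqr. lra. }
    apply Rabs_def2 in Bx; apply Rabs_def2 in By.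
    apply Hmax; lra. }
  rewrite F_in, Hh1 in Hge by lra. lra.
Qed.

(** * The system satisfied by the leading coefficients *)

Lemma C1_inv f : (forall x y, f x y <> 0) -> C1 f -> C1 (fun x y => / f x y).
Proof.
  intros H0 Hf. pose proof Hf as [_ [fx fy]].
  assert (C0 (fun x y => / f x y)) as Ci.
  { intros x y. apply continuity_2d_pt_inv; [now apply C1_C0 | apply H0]. }
  apply C1_intro with (fun x y => -1 * dx f x y * (/ f x y * / f x y))
                      (fun x y => -1 * dy f x y * (/ f x y * / f x y)); smooth.
  - intros x y. replace (-1 * dx f x y * (/ f x y * / f x y))
      with (- dx f x y / f x y ^ 2) by (field; apply H0).
    apply (is_derive_inv (fun s => f s y)); [now apply C1_dx | apply H0].
  - intros x y. replace (-1 * dy f x y * (/ f x y * / f x y))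
      with (- dy f x y / f x y ^ 2) by (field; apply H0).
    apply (is_derive_inv (fun t => f x t)); [now apply C1_dy | apply H0].
Qed.

Lemma dx_inv f : (forall x y, f x y <> 0) -> C1 f ->
  dx (fun x y => / f x y) = fun x y => - dx f x y / f x y ^ 2.
Proof.
  intros H0 Hf. apply dx_eq; intros x y.
  apply (is_derive_inv (fun s => f s y)); [now apply C1_dx | apply H0].
Qed.
Lemma dy_inv f : (forall x y, f x y <> 0) -> C1 f ->
  dy (fun x y => / f x y) = fun x y => - dy f x y / f x y ^ 2.
Proof.
  intros H0 Hf. apply dy_eq; intros x y.
  apply (is_derive_inv (fun t => f x t)); [now apply C1_dy | apply H0].
Qed.

(** The last two hypotheses state that [(B1 - i B2) / a^2] is holomorphic, the
    first that its modulus times [a] is the density of a metric to which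
    [pseudometric_trivial] applies. *)
Lemma dbar_system_trivial (a B1 B2 : R -> R -> R) :
  C2 a -> (forall x y, 0 < a x y) -> C1 B1 -> C1 B2 ->
  (forall x y, log_lap a x y = 16 * (B1 x y ^ 2 + B2 x y ^ 2)) ->
  (forall x y, a x y * (dx B1 x y + dy B2 x y)
               = 2 * (dx a x y * B1 x y + dy a x y * B2 x y)) ->
  (forall x y, a x y * (dx B2 x y - dy B1 x y)
               = 2 * (dx a x y * B2 x y - dy a x y * B1 x y)) ->
  forall x y, B1 x y ^ 2 + B2 x y ^ 2 = 0.
Proof.
  intros Ca a_pos CB1 CB2 Heq H1 H2 x y.
  assert (a_ne : forall x y, a x y <> 0) by (intros u v; specialize (a_pos u v); lra).
  set (g := fun x y => / a x y).
  assert (Cg : C1 g) by (apply C1_inv; [assumption | apply Ca]).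
  set (P := fun x y => B1 x y * (g x y * g x y)).
  set (Q := fun x y => -1 * (B2 x y * (g x y * g x y))).
  assert (HPQ : holo P Q).
  { unfold P, Q. split; [|split]; smooth. intros u v.
    rewrite !dx_mult, !dy_mult, dx_const, dy_const by smooth.
    unfold g. rewrite dx_inv, dy_inv by (assumption || apply Ca).
    specialize (H1 u v); specialize (H2 u v); specialize (a_ne u v).
    split.
    - replace (dx B1 u v) with (2 * (dx a u v * B1 u v + dy a u v * B2 u v) / a u v - dy B2 u v)
        by (rewrite <- H1; field; assumption). field; assumption.
    - replace (dx B2 u v) with (2 * (dx a u v * B2 u v - dy a u v * B1 u v) / a u v + dy B1 u v)
        by (rewrite <- H2; field; assumption). field; assumption. }
  assert (HL : P x y ^ 2 + Q x y ^ 2 = 0).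
  { apply (pseudometric_trivial a P Q 16 x y); try assumption; [lra|].
    intros u v. rewrite Heq. unfold P, Q, g. field. apply a_ne. }
  replace (B1 x y ^ 2 + B2 x y ^ 2) with (a x y ^ 4 * (P x y ^ 2 + Q x y ^ 2)).
  - rewrite HL. ring.
  - unfold P, Q, g. field. apply a_ne.
Qed.

(** * The complex Hessian in real coordinates *)

Lemma dirD_scal {V : NormedModule R_AbsRing} (v : V) (c : R) (f : V -> R) (p : V) :
  dirD v (fun q => c * f q) p = c * dirD v f p.
Proof. apply Derive_scal. Qed.

Lemma dirDC_pair {V : NormedModule R_AbsRing} (v : V) (f g : V -> R) (p : V) :
  dirDC v (fun q => (f q, g q)) p = (dirD v f p, dirD v g p).
Proof. reflexivity. Qed.

Lemma wirt_split {V : NormedModule R_AbsRing} (vx vy : V) (f g : V -> R) (p : V) :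
  wirt vx vy (fun q => (f q, g q)) p
  = ((dirD vx f p + dirD vy g p) / 2, (dirD vx g p - dirD vy f p) / 2).
Proof.
  unfold wirt. rewrite !dirDC_pair. apply injective_projections; simpl; field.
Qed.

Lemma wirtbar_split {V : NormedModule R_AbsRing} (vx vy : V) (f g : V -> R) (p : V) :
  wirtbar vx vy (fun q => (f q, g q)) p
  = ((dirD vx f p - dirD vy g p) / 2, (dirD vx g p + dirD vy f p) / 2).
Proof. unfold wirtbar. rewrite !dirDC_pair. apply injective_projections; simpl; field. Qed.

Lemma dirD_0 {V : NormedModule R_AbsRing} (v : V) (p : V) :
  dirD v (fun _ => 0) p = 0.
Proof. exact (Derive_const 0 0). Qed.

Lemma wirt_real {V : NormedModule R_AbsRing} (vx vy : V) (u : V -> R) :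
  wirt vx vy (fun q => RtoC (u q))
  = fun q => (/ 2 * dirD vx u q, - / 2 * dirD vy u q).
Proof.
  apply functional_extensionality; intros q.
  unfold RtoC. rewrite (wirt_split vx vy u (fun _ => 0)), !dirD_0.
  apply injective_projections; simpl; field.
Qed.

Lemma wirtbar_real {V : NormedModule R_AbsRing} (vx vy : V) (u : V -> R) :
  wirtbar vx vy (fun q => RtoC (u q))
  = fun q => (/ 2 * dirD vx u q, / 2 * dirD vy u q).
Proof.
  apply functional_extensionality; intros q.
  unfold RtoC. rewrite (wirtbar_split vx vy u (fun _ => 0)), !dirD_0.
  apply injective_projections; simpl; field.
Qed.

Lemma det2_entries (m00 m01 m10 m11 : C) :
  det2 [[m00, m01], [m10, m11]] = (m00 * m11 - m01 * m10)%C.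
Proof. reflexivity. Qed.

Definition e_x : CR2 := (RtoC 1, RtoC 0).
Definition e_y : CR2 := (Ci, RtoC 0).
Definition e_s : CR2 := (RtoC 0, RtoC 1).
Definition e_t : CR2 := (RtoC 0, Ci).

(** Only the commutation of [e_x] and [e_y] is assumed: the functions below are
    polynomial in [x] and [y], whereas commutation of [e_s] and [e_t] is
    obtained from the imaginary part of the determinant. *)
Lemma det_complex_hessian (u : CR2 -> R) (p : CR2) :
  let D v w := dirD w (dirD v u) p in
  D e_y e_x = D e_x e_y ->
  det2 (complex_hessian u p) =
    (((D e_x e_x + D e_y e_y) * (D e_s e_s + D e_t e_t)
       - ((D e_x e_s + D e_y e_t) ^ 2 + (D e_y e_s - D e_x e_t) ^ 2)) / 16,
     (D e_x e_x + D e_y e_y) * (D e_t e_s - D e_s e_t) / 16).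
Proof.
  intros D Hxy. unfold complex_hessian. rewrite det2_entries.
  unfold d_z, d_zbar, d_w, d_wbar. fold e_x e_y e_s e_t.
  rewrite (wirt_real (V := CR2) e_x e_y u), (wirtbar_real (V := CR2) e_x e_y u),
    (wirtbar_real (V := CR2) e_s e_t u), !wirt_split, !wirtbar_split, !dirD_scal.
  fold (D e_x e_x) (D e_x e_y) (D e_y e_x) (D e_y e_y) (D e_s e_s) (D e_s e_t)
    (D e_t e_s) (D e_t e_t) (D e_x e_s) (D e_x e_t) (D e_y e_s) (D e_y e_t).
  rewrite Hxy.
  apply injective_projections; simpl; field.
Qed.

(** * Functions that are quadratic in the first variable *)

Definition quad (k : nat -> CR -> R) (p : CR2) : R :=
  let x := Re (fst p) in let y := Im (fst p) in let w := snd p in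
  k 0%nat w * x ^ 2 + k 1%nat w * (x * y) + k 2%nat w * y ^ 2
  + k 3%nat w * x + k 4%nat w * y + k 5%nat w.

Definition quad_x (k : nat -> CR -> R) (i : nat) : CR -> R :=
  match i with
  | 3%nat => fun w => 2 * k 0%nat w | 4%nat => k 1%nat | 5%nat => k 3%nat
  | _ => fun _ => 0
  end.
Definition quad_y (k : nat -> CR -> R) (i : nat) : CR -> R :=
  match i with
  | 3%nat => k 1%nat | 4%nat => fun w => 2 * k 2%nat w | 5%nat => k 4%nat
  | _ => fun _ => 0
  end.

Definition line_derivable (e : CR) (f : CR -> R) : Prop :=
  forall w : CR, ex_derive (fun t : R => f (plus w (scal t e))) 0.

Ltac coords :=
  apply injective_projections; cbn; unfold plus, scal; cbn; unfold mult; cbn;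
  match goal with |- ?a = ?b => change (@eq R a b) end; ring.

Lemma shift_0 (w : CR) (t : R) : plus w (scal t (RtoC 0 : CR)) = w.
Proof. coords. Qed.

Lemma dirD_w_quad (k : nat -> CR -> R) (e : CR) :
  (forall i, line_derivable e (k i)) ->
  dirD (V := CR2) (RtoC 0, e) (quad k) = quad (fun i => dirD e (k i)).
Proof.
  intros Hk. apply functional_extensionality; intros [[x y] w].
  unfold dirD at 1.
  rewrite (Derive_ext _ (fun t => quad k ((x, y), plus w (scal t e)))).
  - apply is_derive_unique. unfold quad; simpl.
    assert (H : forall i, is_derive (fun t : R => k i (plus w (scal t e))) 0 (dirD e (k i) w)).
    { intros i. apply Derive_correct, Hk. }
    repeat apply (is_derive_plus (V := R_NormedModule)); try apply H;
      match goal with |- is_derive (fun t => k ?i _ * ?c) 0 _ =>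
        apply (is_derive_scal_l (V := R_NormedModule) (fun t => k i (plus w (scal t e))) 0 _ c), H
      end.
  - intros t. f_equal. apply injective_projections; [|reflexivity].
    apply (shift_0 (x, y)).
Qed.

Lemma dirD_x_quad (k : nat -> CR -> R) : dirD e_x (quad k) = quad (quad_x k).
Proof.
  apply functional_extensionality; intros [[x y] w].
  unfold dirD.
  rewrite (Derive_ext _ (fun t => quad k ((x + t, y), w))).
  - apply is_derive_unique. unfold quad; simpl. auto_derive; [exact I | ring].
  - intros t. f_equal. apply injective_projections; [|apply shift_0].
    coords.
Qed.

Lemma dirD_y_quad (k : nat -> CR -> R) : dirD e_y (quad k) = quad (quad_y k).
Proof.
  apply functional_extensionality; intros [[x y] w].
  unfold dirD.
  rewrite (Derive_ext _ (fun t => quad k ((x, y + t), w))).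
  - apply is_derive_unique. unfold quad; simpl. auto_derive; [exact I | ring].
  - intros t. f_equal. apply injective_projections; [|apply shift_0].
    coords.
Qed.

(** * Functions on C as functions of two real variables *)

Definition on_plane (f : CR -> R) (x y : R) : R := f (x, y).

Lemma dx_on_plane (f : CR -> R) : dx (on_plane f) = on_plane (dirD (V := CR) (RtoC 1) f).
Proof.
  do 2 (apply functional_extensionality; intro). unfold dx, on_plane, dirD, Derive.
  f_equal. apply Lim_ext; intros h. f_equal; f_equal; f_equal.
  all: coords.
Qed.

Lemma dy_on_plane (f : CR -> R) : dy (on_plane f) = on_plane (dirD (V := CR) Ci f).
Proof.
  do 2 (apply functional_extensionality; intro). unfold dy, on_plane, dirD, Derive.
  f_equal. apply Lim_ext; intros h. f_equal; f_equal; f_equal.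
  all: coords.
Qed.

Lemma C0_on_plane (f : CR -> R) : (forall p, continuous f p) -> C0 (on_plane f).
Proof.
  intros Hf x y eps.
  destruct (proj1 (filterlim_locally f _) (Hf (x, y)) eps) as [del Hdel].
  exists del. intros u v Hu Hv. now apply (Hdel (u, v)).
Qed.

Lemma ex_derive_shift (f g : R -> R) (x : R) :
  (forall s, g s = f (s - x)) -> ex_derive f 0 -> ex_derive g x.
Proof.
  intros Hg Hf. apply (ex_derive_ext (fun s => f (s - x))); [now intros; symmetry|].
  apply (ex_derive_comp f (fun s => s - x)).
  - now rewrite Rminus_diag.
  - auto_derive; auto.
Qed.

Lemma C1_on_plane (f : CR -> R) : class_C 1 f -> C1 (on_plane f).
Proof.
  intros [_ H]. split; [intros x y; split|split].
  - eapply ex_derive_shift; [|apply (proj1 (H (RtoC 1)) (x, y))].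
    intros s. unfold on_plane. f_equal.
    coords.
  - eapply ex_derive_shift; [|apply (proj1 (H Ci) (x, y))].
    intros s. unfold on_plane. f_equal.
    coords.
  - rewrite dx_on_plane. apply C0_on_plane, (proj2 (H (RtoC 1))).
  - rewrite dy_on_plane. apply C0_on_plane, (proj2 (H Ci)).
Qed.

Lemma class_C_weaken {V : NormedModule R_AbsRing} (n : nat) (f : V -> R) :
  class_C (S n) f -> class_C n f.
Proof.
  revert f; induction n as [|n IH]; intros f [H0 H]; [now split|].
  split; [assumption|]. intros v. destruct (H v) as [H1 H2]. split; auto.
Qed.

Lemma C2_on_plane (f : CR -> R) : class_C 2 f -> C2 (on_plane f).
Proof.
  intros H. split; [apply C1_on_plane, class_C_weaken, H|].
  rewrite dx_on_plane, dy_on_plane. split; apply C1_on_plane, (proj2 H).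
Qed.

Lemma dirD_lin {V : NormedModule R_AbsRing} (v : V) (f g : V -> R) (c d : R) :
  (forall p, ex_derive (fun t : R => f (plus p (scal t v))) 0) ->
  (forall p, ex_derive (fun t : R => g (plus p (scal t v))) 0) ->
  dirD v (fun p => c * f p + d * g p) = fun p => c * dirD v f p + d * dirD v g p.
Proof.
  intros Hf Hg. apply functional_extensionality; intros p. unfold dirD.
  rewrite Derive_plus, !Derive_scal; [reflexivity| |];
    now apply ex_derive_scal.
Qed.

Lemma class_C_lin {V : NormedModule R_AbsRing} (n : nat) (f g : V -> R) (c d : R) :
  class_C n f -> class_C n g -> class_C n (fun p => c * f p + d * g p).
Proof.
  revert f g; induction n as [|n IH]; intros f g [f0 Hf] [g0 Hg].
  all: split; [intros p; apply (continuous_plus (K := R_AbsRing) (V := R_NormedModule));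
    now apply (continuous_scal_r (K := R_AbsRing) (V := R_NormedModule))|].
  - exact I.
  - intros v. destruct (Hf v) as [f1 f2], (Hg v) as [g1 g2]. split.
    + intros p. apply (ex_derive_plus (K := R_AbsRing) (V := R_NormedModule));
        now apply ex_derive_scal.
    + rewrite dirD_lin by assumption. now apply IH.
Qed.

(** * Comparing coefficients in the determinant equation *)

Lemma quad_zero (k : nat -> CR -> R) (w : CR) :
  (forall x y : R, quad k ((x, y), w) = 0) -> forall i, (i < 6)%nat -> k i w = 0.
Proof.
  intros H.
  pose proof (H 0 0) as H00; pose proof (H 1 0) as H10; pose proof (H (-1) 0) as H20.
  pose proof (H 0 1) as H01; pose proof (H 0 (-1)) as H02; pose proof (H 1 1) as H11.
  unfold quad in *; simpl in *.
  intros [|[|[|[|[|[|i]]]]]] Hi; try lra. lia.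
Qed.

Definition dS : (CR -> R) -> CR -> R := dirD (V := CR) (RtoC 1).
Definition dT : (CR -> R) -> CR -> R := dirD (V := CR) Ci.

Lemma det_quad (k : nat -> CR -> R) (x y : R) (w : CR) :
  (forall i, class_C 2 (k i)) ->
  let K := 2 * (k 0%nat w + k 2%nat w) in
  let s i := dS (k i) w in let t i := dT (k i) w in
  det2 (complex_hessian (quad k) ((x, y), w)) =
   ((K * quad (fun i w => dS (dS (k i)) w + dT (dT (k i)) w) ((x, y), w)
     - (((2 * s 0%nat + t 1%nat) * x + (s 1%nat + 2 * t 2%nat) * y
         + (s 3%nat + t 4%nat)) ^ 2
        + ((s 1%nat - 2 * t 0%nat) * x + (2 * s 2%nat - t 1%nat) * y
         + (s 4%nat - t 3%nat)) ^ 2)) / 16,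
    K * quad (fun i w => dS (dT (k i)) w - dT (dS (k i)) w) ((x, y), w) / 16).
Proof.
  intros Hk K s t.
  assert (L1 : forall i e, line_derivable e (k i)).
  { intros i e. exact (proj1 (proj2 (Hk i) e)). }
  assert (L2 : forall i e e', line_derivable e (dirD (V := CR) e' (k i))).
  { intros i e e'. exact (proj1 (proj2 (proj2 (proj2 (Hk i) e')) e)). }
  assert (L0 : forall e, line_derivable e (fun _ => 0)).
  { intros e v. apply (ex_derive_const (K := R_AbsRing) (V := R_NormedModule)). }
  assert (Lx : forall i e, line_derivable e (quad_x k i)).
  { intros [|[|[|[|[|[|i]]]]]] e;
      [exact (L0 e) .. | | exact (L1 _ e) | exact (L1 _ e) | exact (L0 e)].
    intros v. apply (ex_derive_scal (fun t : R => k 0%nat (plus v (scal t e)))), L1. }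
  assert (Ly : forall i e, line_derivable e (quad_y k i)).
  { intros [|[|[|[|[|[|i]]]]]] e;
      [exact (L0 e) .. | exact (L1 _ e) | | exact (L1 _ e) | exact (L0 e)].
    intros v. apply (ex_derive_scal (fun t : R => k 2%nat (plus v (scal t e)))), L1. }
  rewrite det_complex_hessian.
  - unfold e_s, e_t. rewrite !dirD_x_quad, !dirD_y_quad, !(dirD_w_quad k) by auto.
    rewrite !dirD_w_quad by auto.
    unfold quad, quad_x, quad_y; cbn [fst snd Re Im].
    rewrite !(dirD_scal (V := CR)), !(dirD_0 (V := CR)).
    unfold K, s, t, dS, dT.
    apply injective_projections; cbn [fst snd]; field.
  - rewrite !dirD_x_quad, !dirD_y_quad, !dirD_x_quad. unfold quad; simpl. ring.
Qed.

Lemma dirD2_lin (e e' : CR) (f g : CR -> R) (c d : R) :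
  class_C 2 f -> class_C 2 g ->
  dirD e' (dirD e (fun w => c * f w + d * g w))
  = fun w => c * dirD e' (dirD e f) w + d * dirD e' (dirD e g) w.
Proof.
  intros [_ Hf] [_ Hg]. destruct (Hf e) as [f1 [_ f2]], (Hg e) as [g1 [_ g2]].
  rewrite dirD_lin by assumption. apply dirD_lin; [apply f2 | apply g2].
Qed.

(** The coefficients of [a |z|^2 + 2 Re (b z^2) + 2 Re (c z) + d] in the sense of
    [quad]; all are kept in the shape of a linear combination so that
    [dirD_lin] and [class_C_lin] apply uniformly. *)
Definition coef (a b1 b2 c1 c2 d : CR -> R) (i : nat) : CR -> R :=
  match i with
  | 0%nat => fun w => 1 * a w + 2 * b1 w
  | 1%nat => fun w => 0 * a w + -4 * b2 w
  | 2%nat => fun w => 1 * a w + -2 * b1 w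
  | 3%nat => fun w => 0 * a w + 2 * c1 w
  | 4%nat => fun w => 0 * a w + -2 * c2 w
  | _ => d
  end.

(** The real part of the equation is [K * Laplacian - p^2 - q^2 = 16] with [p]
    and [q] affine in [(x, y)]; its coefficients of [x^2], [xy] and [y^2] are
    the first three conclusions.  Here [K / 4] is [u_(z zbar)].  The imaginary part is [K] times the
    commutator of [dS] and [dT], whence the symmetry of second derivatives. *)
Lemma quad_det_one (k : nat -> CR -> R) (w : CR) :
  (forall i, class_C 2 (k i)) -> k 0%nat w + k 2%nat w <> 0 ->
  (forall z : C, det2 (complex_hessian (quad k) (z, w)) = RtoC 1) ->
  let K := 2 * (k 0%nat w + k 2%nat w) in
  let s i := dS (k i) w in let t i := dT (k i) w in
  let L i := dS (dS (k i)) w + dT (dT (k i)) w in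
  K * L 0%nat = (2 * s 0%nat + t 1%nat) ^ 2 + (s 1%nat - 2 * t 0%nat) ^ 2 /\
  K * L 1%nat = 2 * ((2 * s 0%nat + t 1%nat) * (s 1%nat + 2 * t 2%nat)
                     + (s 1%nat - 2 * t 0%nat) * (2 * s 2%nat - t 1%nat)) /\
  K * L 2%nat = (s 1%nat + 2 * t 2%nat) ^ 2 + (2 * s 2%nat - t 1%nat) ^ 2 /\
  forall i, (i < 6)%nat -> dS (dT (k i)) w = dT (dS (k i)) w.
Proof.
  intros Hk HK Hdet K s t L.
  set (p3 := s 3%nat + t 4%nat). set (q3 := s 4%nat - t 3%nat).
  set (p1 := 2 * s 0%nat + t 1%nat). set (p2 := s 1%nat + 2 * t 2%nat).
  set (q1 := s 1%nat - 2 * t 0%nat). set (q2 := 2 * s 2%nat - t 1%nat).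
  set (re := fun (i : nat) (_ : CR) => match i with
     | 0%nat => K * L 0%nat - (p1 ^ 2 + q1 ^ 2)
     | 1%nat => K * L 1%nat - 2 * (p1 * p2 + q1 * q2)
     | 2%nat => K * L 2%nat - (p2 ^ 2 + q2 ^ 2)
     | 3%nat => K * L 3%nat - 2 * (p1 * p3 + q1 * q3)
     | 4%nat => K * L 4%nat - 2 * (p2 * p3 + q2 * q3)
     | _ => K * L 5%nat - (p3 ^ 2 + q3 ^ 2) - 16 end).
  assert (Hxy : forall x y : R,
    K * quad (fun i w => dS (dS (k i)) w + dT (dT (k i)) w) ((x, y), w)
     - ((p1 * x + p2 * y + p3) ^ 2 + (q1 * x + q2 * y + q3) ^ 2) = 16 /\
    K * quad (fun i w => dS (dT (k i)) w - dT (dS (k i)) w) ((x, y), w) = 0).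
  { intros x y. specialize (Hdet (x, y)). rewrite det_quad in Hdet by assumption.
    pose proof (f_equal fst Hdet) as Hr; pose proof (f_equal snd Hdet) as Hi.
    cbn [fst snd RtoC] in Hr, Hi. fold K in Hr, Hi.
    fold (s 0%nat) (s 1%nat) (s 2%nat) (s 3%nat) (s 4%nat)
      (t 0%nat) (t 1%nat) (t 2%nat) (t 3%nat) (t 4%nat) in Hr.
    fold p1 p2 p3 q1 q2 q3 in Hr.
    split; lra. }
  assert (Hre : forall i, (i < 6)%nat -> re i w = 0).
  { apply quad_zero. intros x y. destruct (Hxy x y) as [Hr _].
    apply (Rplus_eq_reg_r 16). rewrite <- Hr at 2.
    unfold quad, re, L; cbn [fst snd Re Im]. ring. }
  split; [|split; [|split]].
  - apply Rminus_diag_uniq. apply (Hre 0%nat). lia.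
  - apply Rminus_diag_uniq. apply (Hre 1%nat). lia.
  - apply Rminus_diag_uniq. apply (Hre 2%nat). lia.
  - intros i Hi. apply Rminus_diag_uniq.
    apply (quad_zero (fun i w => dS (dT (k i)) w - dT (dS (k i)) w) w); [|assumption].
    intros x y. destruct (Hxy x y) as [_ H].
    apply Rmult_integral in H. destruct H as [H | H]; [|assumption].
    destruct HK. unfold K in H. lra.
Qed.

Lemma coef_C2 (a b1 b2 c1 c2 d : CR -> R) :
  class_C 2 a -> class_C 2 b1 -> class_C 2 b2 -> class_C 2 c1 -> class_C 2 c2 ->
  class_C 2 d -> forall i, class_C 2 (coef a b1 b2 c1 c2 d i).
Proof.
  intros Ha Hb1 Hb2 Hc1 Hc2 Hd [|[|[|[|[|i]]]]]; first [exact Hd | now apply class_C_lin].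
Qed.

(** Here [B1 + i B2] is the derivative of [b1 + i b2] with respect to [wbar].
    The sum of the [x^2] and [y^2] coefficients gives the first equation, their
    difference the second one, and the [xy] coefficient the third. *)
Lemma coefficient_equations (a b1 b2 c1 c2 d : CR -> R) (w : CR) :
  class_C 2 a -> class_C 2 b1 -> class_C 2 b2 -> class_C 2 c1 -> class_C 2 c2 ->
  class_C 2 d -> 0 < a w ->
  (forall z : C, det2 (complex_hessian (quad (coef a b1 b2 c1 c2 d)) (z, w)) = RtoC 1) ->
  let B1 w := / 2 * dS b1 w + - / 2 * dT b2 w in
  let B2 w := / 2 * dS b2 w + / 2 * dT b1 w in
  a w * (dS (dS a) w + dT (dT a) w) - (dS a w ^ 2 + dT a w ^ 2)
    = 16 * (B1 w ^ 2 + B2 w ^ 2) /\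
  a w * (dS B1 w + dT B2 w) = 2 * (dS a w * B1 w + dT a w * B2 w) /\
  a w * (dS B2 w - dT B1 w) = 2 * (dS a w * B2 w - dT a w * B1 w).
Proof.
  intros Ha Hb1 Hb2 Hc1 Hc2 Hd a_pos Hdet B1 B2.
  set (k := coef a b1 b2 c1 c2 d) in *.
  assert (Hk : forall i, class_C 2 (k i)) by now apply coef_C2.
  destruct (quad_det_one k w Hk) as [E0 [E1 [E2 EJ]]]; [|assumption|].
  { unfold k, coef. lra. }
  pose proof (EJ 0%nat ltac:(lia)) as J0. pose proof (EJ 1%nat ltac:(lia)) as J1.
  pose proof (EJ 2%nat ltac:(lia)) as J2. clear EJ Hdet Hk.
  unfold k, coef, dS, dT in E0, E1, E2, J0, J1, J2.
  assert (D1 : forall (e : CR) f, class_C 2 f -> forall p : CR,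
    ex_derive (fun t : R => f (plus p (scal t e))) 0).
  { intros e f Hf. exact (proj1 (proj2 Hf e)). }
  assert (D2 : forall (e e' : CR) f, class_C 2 f -> forall p : CR,
    ex_derive (fun t : R => dirD (V := CR) e f (plus p (scal t e'))) 0).
  { intros e e' f Hf. exact (proj1 (proj2 (proj2 (proj2 Hf e)) e')). }
  rewrite !(dirD2_lin) in E0, E1, E2, J0, J1, J2 by assumption.
  rewrite !(dirD_lin (V := CR)) in E0, E1, E2 by auto.
  rewrite !(dirD_lin (V := CR)) in E1 by auto.
  unfold B1, B2, dS, dT.
  rewrite !(dirD_lin (V := CR)) by auto.
  assert (Jb1 : dirD (V := CR) Ci (dirD (V := CR) (RtoC 1) b1) w
                = dirD (V := CR) (RtoC 1) (dirD (V := CR) Ci b1) w) by lra.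
  assert (Jb2 : dirD (V := CR) Ci (dirD (V := CR) (RtoC 1) b2) w
                = dirD (V := CR) (RtoC 1) (dirD (V := CR) Ci b2) w) by lra.
  rewrite Jb1, Jb2. clear J0 J1 J2.
  split; [|split]; lra.
Qed.

Lemma normal_form (u : CR2 -> R) (a : CR -> R) (b c : CR -> C) (d : CR -> R) :
  (forall z w : C,
    RtoC (u (z, w)) =
      (RtoC (a w) * RtoC (Cmod z ^ 2) + b w * z ^ 2 + Cconj (b w * z ^ 2)
       + c w * z + Cconj (c w * z) + RtoC (d w))%C) ->
  u = quad (coef a (fun w => Re (b w)) (fun w => Im (b w))
                   (fun w => Re (c w)) (fun w => Im (c w)) d).
Proof.
  intros Hu. apply functional_extensionality; intros [[x y] w].
  assert (Hmod : Cmod (x, y) ^ 2 = x ^ 2 + y ^ 2).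
  { unfold Cmod. simpl fst; simpl snd. rewrite pow2_sqrt; [reflexivity|].
    pose proof (pow2_ge_0 x); pose proof (pow2_ge_0 y); lra. }
  apply (eq_trans (f_equal fst (Hu (x, y) w))). rewrite Hmod.
  unfold quad, coef, Re, Im; simpl. ring.
Qed.

Theorem theorem4p2
  (u : CR2 -> R) (a : CR -> R) (b c : CR -> C) (d : CR -> R)
  (u_C2 : class_C 2 u)
  (a_C2 : class_C 2 a) (b_C2 : class_CC 2 b)
  (c_C2 : class_CC 2 c) (d_C2 : class_C 2 d)
  (a_pos : forall w : C, (0 < a w)%R)
  (u_form : forall z w : C,
    RtoC (u (z, w)) =
      (RtoC (a w) * RtoC (Cmod z ^ 2) + b w * z ^ 2 + Cconj (b w * z ^ 2)
       + c w * z + Cconj (c w * z) + RtoC (d w))%C)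
  (det_u : forall p : C * C, det2 (complex_hessian u p) = RtoC 1) :
  exists w : C, Zset b w.
Proof.
  rewrite (normal_form u a b c d u_form) in det_u.
  destruct b_C2 as [Cb1 Cb2], c_C2 as [Cc1 Cc2].
  set (b1 := fun w : CR => Re (b w)) in *. set (b2 := fun w : CR => Im (b w)) in *.
  set (c1 := fun w : CR => Re (c w)) in *. set (c2 := fun w : CR => Im (c w)) in *.
  set (B1 := fun w => / 2 * dS b1 w + - / 2 * dT b2 w).
  set (B2 := fun w => / 2 * dS b2 w + / 2 * dT b1 w).
  assert (E : forall w : CR, _) by exact (fun w => coefficient_equations a b1 b2 c1 c2 d w
    a_C2 Cb1 Cb2 Cc1 Cc2 d_C2 (a_pos w) (fun z => det_u (z, w))).
  fold B1 B2 in E. cbv zeta in E.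
  assert (CB1 : class_C 1 B1).
  { apply class_C_lin; [apply (proj2 Cb1) | apply (proj2 Cb2)]. }
  assert (CB2 : class_C 1 B2).
  { apply class_C_lin; [apply (proj2 Cb2) | apply (proj2 Cb1)]. }
  assert (HB : on_plane B1 0 0 ^ 2 + on_plane B2 0 0 ^ 2 = 0).
  { apply (dbar_system_trivial (on_plane a)).
    - now apply C2_on_plane.
    - intros x y. apply a_pos.
    - now apply C1_on_plane.
    - now apply C1_on_plane.
    - intros x y. unfold log_lap, lap. rewrite !dx_on_plane, !dy_on_plane.
      apply (E (x, y)).
    - intros x y. rewrite !dx_on_plane, !dy_on_plane. apply (E (x, y)).
    - intros x y. rewrite !dx_on_plane, !dy_on_plane. apply (E (x, y)). }
  exists (0, 0). unfold Zset.
  change (dbar1 b (0, 0)) with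
    (wirtbar (V := CR) (RtoC 1) Ci (fun w => (b1 w, b2 w)) (0, 0)).
  rewrite wirtbar_split.
  unfold on_plane in HB.
  pose proof (pow2_ge_0 (B1 (0, 0))); pose proof (pow2_ge_0 (B2 (0, 0))).
  assert (H1 : B1 (0, 0) = 0) by (apply Rsqr_0_uniq; unfold Rsqr; lra).
  assert (H2 : B2 (0, 0) = 0) by (apply Rsqr_0_uniq; unfold Rsqr; lra).
  unfold B1 in H1; unfold B2 in H2.
  unfold dS, dT in H1, H2.
  apply injective_projections; cbn [fst snd RtoC]; lra.
Qed.
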